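(* Let $C_1$ be an $[n,k,n-k]_qR_1$ NMDS code over $\mathbb{F}_q$, and for $m\ge1$ let $C_m$ be its $m$-lifted code, an $[n,k,n-k]_{q^m}R_m$ NMDS code over $\mathbb{F}_{q^m}$. Suppose $$A_{n-k}(C_1)=\binom{n}{k+1}\frac{q-1}{n-k}.$$ Then: (i) for every $m\ge n-k$, $R_m=n-k$ and $C_m$ is a UPWS NMDS code (so $\{C_m\}_{m\ge n-k}$ is an infinite family of UPWS NMDS codes); (ii) if $R_{m'}=n-k$ for some $m'<n-k$, then for every $m\ge m'$, $R_m=n-k$ and $C_m$ is a UPWS NMDS code.
   Context: An $[n,k,d]_qR$ code is a $k$-dimensional linear subspace of $\mathbb{F}_q^n$ with minimum Hamming distance $d$ and covering radius $R$ (least integer such that every vector of $\mathbb{F}_q^n$ is within distance $R$ of some codeword). $A_i(C)$ is the number of codewords of weight $i$. A linear $[n,k,n-k]_q$ code $C$ is near-MDS (NMDS) if its dual $C^\perp$ is an $[n,n-k,k]_q$ code. For a linear code $C$ over $\mathbb{F}_q$ with parity check matrix $H\in\mathbb{F}_q^{(n-k)\times n}$, the $m$-lifted code $C_m$ ($m\ge1$) is the code over $\mathbb{F}_{q^m}$ with the same parity check matrix: $C_m=\{x\in\mathbb{F}_{q^m}^n:Hx^T=0\}$ (the $\mathbb{F}_{q^m}$-span of $C$); it has the same length, dimension and minimum distance as $C$. $B_j(v,C)$ is the number of codewords at Hamming distance $j$ from $v$; a code with covering radius $R$ is uniformly packed in the wide sense (UPWS) if there are rationals $\beta_0,\dots,\beta_R$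 with $\sum_{j=0}^R\beta_jB_j(v,C)=1$ for all $v\in\mathbb{F}_q^n$. *)

(* Defs.v *)
From mathcomp Require Import all_boot all_order all_algebra.

Set Implicit Arguments.
Unset Strict Implicit.
Unset Printing Implicit Defensive.

Import GRing.Theory.
Local Open Scope ring_scope.

(* A linear code of length n over F is a subspace of F^n; its length is the
   dimension n of the ambient space of row vectors. *)

Definition hamming_weight (F : finFieldType) (n : nat) (x : 'rV[F]_n) : nat :=
  #|[set i | x 0 i != 0]|.

Definition hamming_dist (F : finFieldType) (n : nat) (x y : 'rV[F]_n) : nat :=
  #|[set i | x 0 i != y 0 i]|.

(* A_i(C) *)
Definition weight_count (F : finFieldType) (n : nat)
    (C : {vspace 'rV[F]_n}) (i : nat) : nat :=
  #|[set c : 'rV[F]_n | (c \in C) && (hamming_weight c == i)]|.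

(* B_j(v, C) *)
Definition dist_count (F : finFieldType) (n : nat)
    (v : 'rV[F]_n) (C : {vspace 'rV[F]_n}) (j : nat) : nat :=
  #|[set c : 'rV[F]_n | (c \in C) && (hamming_dist v c == j)]|.

(* Fails for every d when C = 0: the zero code has no minimum distance. *)
Definition has_min_dist (F : finFieldType) (n : nat)
    (C : {vspace 'rV[F]_n}) (d : nat) : Prop :=
  (exists x y : 'rV[F]_n,
     [/\ x \in C, y \in C, x != y & hamming_dist x y = d]) /\
  (forall x y : 'rV[F]_n,
     x \in C -> y \in C -> x != y -> (d <= hamming_dist x y)%N).

Definition covers (F : finFieldType) (n : nat)
    (C : {vspace 'rV[F]_n}) (r : nat) : bool :=
  [forall v : 'rV[F]_n, exists c : 'rV[F]_n,
     (c \in C) && (hamming_dist v c <= r)%N].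

Lemma covers_ex (F : finFieldType) (n : nat) (C : {vspace 'rV[F]_n}) :
  exists r, covers C r.
Proof.
exists n; apply/forallP => v; apply/existsP; exists 0.
by rewrite mem0v /=; apply: leq_trans (max_card _) _; rewrite card_ord.
Qed.

Definition covering_radius (F : finFieldType) (n : nat)
    (C : {vspace 'rV[F]_n}) : nat :=
  ex_minn (covers_ex C).

(* [n, k, d]_q code *)
Definition is_code (F : finFieldType) (n : nat)
    (C : {vspace 'rV[F]_n}) (k d : nat) : Prop :=
  \dim C = k /\ has_min_dist C d.

(* [n, k, d]_q R code *)
Definition is_codeR (F : finFieldType) (n : nat)
    (C : {vspace 'rV[F]_n}) (k d R : nat) : Prop :=
  is_code C k d /\ covering_radius C = R.

Definition dual_code (F : finFieldType) (n : nat)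
    (C : {vspace 'rV[F]_n}) : {vspace 'rV[F]_n} :=
  (\bigcap_(x : 'rV[F]_n | x \in C) lker (linfun (mulmxr x^T)))%VS.

Lemma mem_dual_code (F : finFieldType) (n : nat)
    (C : {vspace 'rV[F]_n}) (y : 'rV[F]_n) :
  y \in dual_code C <->
  (forall x : 'rV[F]_n, x \in C -> \sum_i x 0 i * y 0 i = 0).
Proof.
have dotE (x : 'rV[F]_n) :
    (y \in lker (linfun (mulmxr x^T))) = (\sum_i x 0 i * y 0 i == 0).
  have yxE : (y *m x^T) 0 0 = \sum_i x 0 i * y 0 i.
    by rewrite mxE; apply: eq_bigr => i _; rewrite mxE mulrC.
  rewrite memv_ker lfunE /= -yxE; apply/eqP/eqP => [->|yx0]; first by rewrite mxE.
  by apply/matrixP => i j; rewrite !ord1 yx0 mxE.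
rewrite /dual_code memvE; split=> [/subv_bigcapP yC x xC | yC].
  by apply/eqP; rewrite -dotE memvE yC.
by apply/subv_bigcapP => x xC; rewrite -memvE dotE; apply/eqP/yC.
Qed.

Definition is_NMDS (F : finFieldType) (n : nat)
    (C : {vspace 'rV[F]_n}) (k : nat) : Prop :=
  is_code C k (n - k) /\ is_code (dual_code C) (n - k) k.

Definition is_UPWS (F : finFieldType) (n : nat) (C : {vspace 'rV[F]_n}) : Prop :=
  exists beta : 'I_(covering_radius C).+1 -> rat,
    forall v : 'rV[F]_n,
      \sum_(j < (covering_radius C).+1) beta j * (dist_count v C j)%:R = 1.

Definition null_code (F : finFieldType) (r n : nat)
    (H : 'M[F]_(r, n)) : {vspace 'rV[F]_n} :=
  lker (linfun (mulmxr H^T)).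

Lemma mem_null_code (F : finFieldType) (r n : nat)
    (H : 'M[F]_(r, n)) (x : 'rV[F]_n) :
  (x \in null_code H) = (H *m x^T == 0).
Proof.
by rewrite memv_ker lfunE /= -(inj_eq trmx_inj) trmx_mul trmxK trmx0.
Qed.

Definition parity_check_matrix (F : finFieldType) (r n : nat)
    (H : 'M[F]_(r, n)) (C : {vspace 'rV[F]_n}) : Prop :=
  forall x : 'rV[F]_n, (x \in C) = (H *m x^T == 0).

(* The field of order q ^ m is given by a finite field L of that order with an
   embedding of F; the choice of embedding is immaterial. *)
Definition lifted_code (F L : finFieldType) (iota : {rmorphism F -> L})
    (r n : nat) (H : 'M[F]_(r, n)) : {vspace 'rV[L]_n} :=
  null_code (map_mx iota H).

(* Main.v *)
Require Import Defs.
From mathcomp Require Import all_boot all_order all_fingroup all_algebra.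
From mathcomp Require Import all_solvable all_field.

(* Put r = n - k.  A min-weight word of an NMDS code is determined up to a
   scalar by its support, and the hyperplane spanned by r - 1 columns of H has at
   most r columns because the dual distance is k; hence r - 1 coordinates lie in
   at most one such support, and the extremal value of A_r says that the supports
   ("blocks") form a Steiner system S(r - 1, r, n).  The matroid of the columns of H,
   hence the blocks, are unchanged over an extension field L.

   For a syndrome s let N_T be the number of e supported in T with H e^T = s.  If
   |T| = r, then N_T = 1 when T is not a block and N_T = |L| N_(T - i) for every i
   in T when T is a block.  As every (r-1)-set lies in exactly one block,
     r sum_(|T| = r) N_T = r #nonblocks + |L| sum_(|T| = r - 1) N_T,
   and sum_(|T| = t) N_T = sum_j 'C(n - j, n - t) B_j.  This is a relation
   sum_(j <= r) beta_j B_j = 1, i.e. uniform packing as soon as R = r.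

   Finally R = r iff some s in L^r avoids all the hyperplanes of F^r spanned by
   columns of H.  This survives an F-linear injection of L into a larger
   extension, and holds for s with F-independent entries. *)

Set Implicit Arguments.
Unset Strict Implicit.
Unset Printing Implicit Defensive.

Import GRing.Theory.
Local Open Scope ring_scope.

(** * Subsets and supersets of prescribed size *)

Lemma exists_subset_card (T : finType) (A : {set T}) (t : nat) :
  (t <= #|A|)%N -> exists2 S : {set T}, S \subset A & #|S| = t.
Proof.
rewrite -bin_gt0 -cards_draws card_gt0 => /set0Pn[S].
by rewrite inE => /andP[sSA /eqP cS]; exists S.
Qed.

Lemma exists_superset_card (T : finType) (A : {set T}) (t : nat) :
  (#|A| <= t)%N -> (t <= #|T|)%N ->
  exists2 S : {set T}, A \subset S & #|S| = t.
Proof.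
move=> leAt letT.
have [|S sS cS] := @exists_subset_card _ (~: A) (#|T| - t)%N.
  by rewrite cardsCs setCK leq_sub2l.
exists (~: S); first by rewrite subsetC.
by apply/eqP; rewrite cardsCs setCK cS subKn.
Qed.

Lemma card_supersets (T : finType) (A : {set T}) (t : nat) :
  (t <= #|T|)%N ->
  #|[set S : {set T} | (#|S| == t) && (A \subset S)]|
    = 'C(#|T| - #|A|, #|T| - t).
Proof.
move=> letT; have -> : (#|T| - #|A|)%N = #|~: A|.
  by rewrite -(cardsC A) addKn.
rewrite -cards_draws -(card_imset _ (@setC_inj T)).
apply: eq_card => S; rewrite inE -[S in LHS]setCK mem_imset ?inE; last exact: setC_inj.
rewrite andbC [A \subset _]subsetC; congr (_ && _).
by rewrite [in RHS]cardsCs eqn_sub2lE ?max_card.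
Qed.

(** * Supports of vectors *)

Section Support.

Variables (K : finFieldType) (n : nat).
Implicit Types (e c : 'rV[K]_n) (T : {set 'I_n}).

Definition supp e : {set 'I_n} := [set i | e 0 i != 0].

Lemma suppP e T : reflect (forall i, i \notin T -> e 0 i = 0) (supp e \subset T).
Proof.
apply: (iffP subsetP) => eT i; last by rewrite inE; apply: contraR => /eT ->.
by apply: contraNeq => ei; apply: eT; rewrite inE.
Qed.

Lemma supp_eq0 e : (supp e == set0) = (e == 0).
Proof.
rewrite -subset0; apply/suppP/eqP => [e0|-> i]; last by rewrite mxE.
by apply/rowP => i; rewrite mxE e0 ?inE.
Qed.

Lemma supp_sub e c T :
  supp e \subset T -> supp c \subset T -> supp (e - c) \subset T.
Proof.
by move=> /suppP eT /suppP cT; apply/suppP => i iT; rewrite !mxE eT ?cT ?subrr.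
Qed.

Lemma suppZ a c : a != 0 -> supp (a *: c) = supp c.
Proof. by move=> a0; apply/setP => i; rewrite !inE mxE mulf_eq0 (negPf a0). Qed.

Lemma hamming_distE e c : hamming_dist e c = #|supp (e - c)|.
Proof. by apply: eq_card => i; rewrite !inE !mxE subr_eq0. Qed.

Lemma card_supp_subset T :
  #|[set e : 'rV[K]_n | supp e \subset T]| = (#|K| ^ #|T|)%N.
Proof.
rewrite -(card_pffun_on 0 (mem T) predT).
rewrite -(@card_imset _ _ (fun f : {ffun 'I_n -> K} => \row_i f i)); last first.
  by move=> f g /rowP fg; apply/ffunP => i; have := fg i; rewrite !mxE.
apply: eq_card => e; rewrite inE; apply/idP/imsetP => [/suppP eT|[f fT ->]].
  exists [ffun i => e 0 i]; last by apply/rowP => i; rewrite mxE ffunE.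
  apply/pffun_onP; split => //; apply/subsetP => i; rewrite inE ffunE /=.
  by apply: contraR => /eT ->.
have [/subsetP sf _] := pffun_onP fT.
apply/suppP => i; rewrite mxE; apply: contraNeq => fi.
by apply: sf; rewrite inE.
Qed.

Lemma row_mul_supp (y e : 'rV[K]_n) T :
  supp e \subset T -> (forall i, i \in T -> y 0 i = 0) -> y *m e^T = 0.
Proof.
move=> /suppP eT yT; apply/matrixP => i j; rewrite !ord1 !mxE big1 // => l _.
by rewrite !mxE; case: (boolP (l \in T)) => [/yT -> | /eT ->];
  rewrite ?mul0r ?mulr0.
Qed.

(** Pigeonhole: restricting [u *m H] to [T] maps [#|K| ^ r] vectors to at most [#|K| ^ #|T|], so two
    vectors [u] collide, and their difference is the required one. *)
Lemma exists_vanishing r (H : 'M[K]_(r, n)) T : (#|T| < r)%N ->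
  exists2 u : 'rV[K]_r, u != 0 & forall i, i \in T -> (u *m H) 0 i = 0.
Proof.
move=> ltTr.
pose f (u : 'rV[K]_r) : 'rV[K]_n := \row_i (if i \in T then (u *m H) 0 i else 0).
have /injectivePn[u [v neq fuv]] : ~~ injectiveb f.
  apply: contraL ltTr => /injectiveP f_inj; rewrite -leqNgt.
  rewrite -(leq_exp2l (m := #|K|)) ?finNzRing_gt1 //.
  rewrite -card_supp_subset -[r in X in (X <= _)%N]mul1n.
  rewrite -(card_mx K 1 r) -(card_imset _ f_inj).
  apply: subset_leq_card; apply/subsetP => _ /imsetP[u _ ->].
  by rewrite inE; apply/suppP => i iT; rewrite mxE (negPf iT).
exists (u - v) => [|i iT]; first by rewrite subr_eq0.
have /rowP/(_ i) := fuv; rewrite [LHS]mxE [RHS]mxE iT => fuvi.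
by rewrite mulmxBl [LHS]mxE [X in _ + X]mxE fuvi subrr.
Qed.

End Support.

(** * Parity check matrices with a Steiner system of circuits *)

Definition extensions n (B : {set {set 'I_n}}) (T : {set 'I_n}) : {set 'I_n} :=
  [set i | (i \notin T) && (i |: T \in B)].

(** The blocks are the [r]-sets of linearly dependent columns, and each of them is a circuit
    carrying a word of full support. [block_ext] is the Steiner axiom: each [(r-1)]-set lies in
    exactly one block. *)
Record steiner_circuits (K : finFieldType) (r n : nat) (H : 'M[K]_(r, n))
    (B : {set {set 'I_n}}) : Prop := SteinerCircuits {
  block_card : forall T, T \in B -> #|T| = r;
  block_word : forall T, T \in B -> exists2 c, H *m c^T = 0 & supp c = T;
  nonblock_free : forall T : {set 'I_n}, #|T| = r -> T \notin B ->
    forall e : 'rV_n, supp e \subset T -> H *m e^T = 0 -> e = 0;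
  block_ext : forall T : {set 'I_n}, #|T|.+1 = r ->
    #|extensions B T| = 1%N
}.

Lemma syndromeP (K : fieldType) r n (H : 'M[K]_(r, n)) (a : K) (c e : 'rV_n) :
  H *m (a *: c + e)^T = a *: (H *m c^T) + H *m e^T.
Proof. by rewrite [(_ + _)^T]linearP /= mulmxDr -scalemxAr. Qed.

Lemma syndromeB (K : fieldType) r n (H : 'M[K]_(r, n)) (c e : 'rV_n) :
  H *m (c - e)^T = H *m c^T - H *m e^T.
Proof. by rewrite [(_ - _)^T]raddfB /= mulmxBr. Qed.

(** In the vanishing product of [y] and [c] only the term [y 0 i * c 0 i] survives. *)
Lemma vanishing_coord (K : fieldType) n (y c : 'rV[K]_n) i :
  y *m c^T = 0 -> c 0 i != 0 -> (forall j, c 0 j != 0 -> j != i -> y 0 j = 0) ->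
  y 0 i = 0.
Proof.
move=> yc ci yj; have : (y *m c^T) 0 0 = 0 by rewrite yc mxE.
rewrite mxE (bigD1 i) //= big1 ?addr0 => [|l li]; rewrite [c^T _ _]mxE.
  by move=> /eqP; rewrite mulf_eq0 (negPf ci) orbF => /eqP.
by have [->|cl] := eqVneq (c 0 l) 0; rewrite ?mulr0 // yj ?mul0r.
Qed.

(** * Solutions of a syndrome equation on blocks and nonblocks *)

Section SteinerCircuits.

Variables (K : finFieldType) (r n : nat) (H : 'M[K]_(r, n)).
Variable B : {set {set 'I_n}}.
Hypotheses (sc : steiner_circuits H B) (r_gt0 : (0 < r)%N) (ltrn : (r < n)%N).
Implicit Types (e c : 'rV[K]_n) (s : 'cV[K]_r) (T : {set 'I_n}).

(** Of the [n - r + 1] points outside [T], at least two since [r < n], exactly one completes [T] to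
    a block. *)
Lemma exists_nonblock_ext T : #|T|.+1 = r ->
  exists2 i, i \notin T & i |: T \notin B.
Proof.
move=> cT; have cB := block_ext sc cT.
have : (#|extensions B T| < #|~: T|)%N.
  by rewrite cB cardsCs setCK card_ord ltn_subRL addn1 cT.
move=> lt_ext; have /subsetPn[i] : ~~ (~: T \subset extensions B T).
  by apply: contraTN lt_ext => /subset_leq_card; rewrite -leqNgt.
rewrite !inE => iT; rewrite iT /= => iB.
by exists i.
Qed.

Lemma few_columns_free e : (#|supp e| < r)%N -> H *m e^T = 0 -> e = 0.
Proof.
move=> lter He; have [||T eT cT] := @exists_superset_card _ (supp e) r.-1.
- by rewrite -ltnS prednK.
- by rewrite card_ord (leq_trans (leq_pred _)) // ltnW.
have [|i iT iB] := @exists_nonblock_ext T; first by rewrite cT prednK.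
apply: (nonblock_free sc _ iB) => //; first by rewrite cardsU1 iT cT add1n prednK.
by rewrite (subset_trans eT) // subsetUr.
Qed.

Lemma exists_nonblock : exists2 T : {set 'I_n}, #|T| = r & T \notin B.
Proof.
have [||T _ cT] := @exists_superset_card _ (set0 : {set 'I_n}) r.-1.
- by rewrite cards0.
- by rewrite card_ord (leq_trans (leq_pred _)) // ltnW.
have [|i iT iB] := @exists_nonblock_ext T; first by rewrite cT prednK.
by exists (i |: T) => //; rewrite cardsU1 iT cT add1n prednK.
Qed.

Lemma exists_block : exists T, T \in B.
Proof.
have [||T _ cT] := @exists_superset_card _ (set0 : {set 'I_n}) r.-1.
- by rewrite cards0.
- by rewrite card_ord (leq_trans (leq_pred _)) // ltnW.
have cT' : #|T|.+1 = r by rewrite cT prednK.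
have /cards1P[i iP] := introT eqP (block_ext sc cT').
have : i \in [set i] by rewrite inE.
by rewrite -iP inE => /andP[_ ?]; exists (i |: T).
Qed.

Definition solutions s T := [set e | (supp e \subset T) && (H *m e^T == s)].

(** The syndrome map is injective on the [#|K| ^ r] vectors supported in [T], and there are equally
    many syndromes. *)
Lemma nonblock_span T s : #|T| = r -> T \notin B ->
  exists2 e, supp e \subset T & H *m e^T = s.
Proof.
move=> cT TB; pose A := [set e : 'rV[K]_n | supp e \subset T].
have f_inj : {in A &, injective (fun e => H *m e^T)}.
  move=> e c; rewrite !inE => eT cTT /eqP; rewrite -subr_eq0 -syndromeB.
  move=> /eqP/(nonblock_free sc cT TB (supp_sub eT cTT))/eqP.
  by rewrite subr_eq0 => /eqP.
have /eqP fA : [set H *m e^T | e in A] == setT.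
  by rewrite eqEcard subsetT cardsT card_mx muln1 (card_in_imset f_inj)
             card_supp_subset cT leqnn.
have : s \in [set H *m e^T | e in A] by rewrite fA inE.
by case/imsetP => e; rewrite inE => eT ->; exists e.
Qed.

Lemma syndrome_onto s : exists e, H *m e^T = s.
Proof.
have [T cT TB] := exists_nonblock.
by have [e _ <-] := nonblock_span s cT TB; exists e.
Qed.

Lemma card_solutions_nonblock T s : #|T| = r -> T \notin B ->
  #|solutions s T| = 1%N.
Proof.
move=> cT TB; have [e eT He] := nonblock_span s cT TB.
apply/eqP/cards1P; exists e; apply/setP => c; rewrite !inE.
apply/andP/eqP => [[cT' /eqP Hc]|->]; last by rewrite eT He.
apply/eqP; rewrite -subr_eq0; apply/eqP.
apply: (nonblock_free sc cT TB (supp_sub cT' eT)).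
by rewrite syndromeB Hc He subrr.
Qed.

(** If [c] is a word with support [T], every solution on [T] is uniquely a multiple of [c] plus a
    solution vanishing at [i]. *)
Lemma card_solutions_block T i s : T \in B -> i \in T ->
  #|solutions s T| = (#|K| * #|solutions s (T :\ i)|)%N.
Proof.
move=> TB iT; have [c Hc sc_c] := block_word sc TB.
have ci : c 0 i != 0 by move: iT; rewrite -sc_c inE.
have cT : supp c \subset T by rewrite sc_c.
pose f (p : K * 'rV[K]_n) := p.1 *: c + p.2.
have -> : (#|K| * #|solutions s (T :\ i)| = #|setX [set: K] (solutions s (T :\ i))|)%N.
  by rewrite cardsX cardsT.
rewrite -(@card_in_imset _ _ f); last first.
  move=> [a e] [a' e']; rewrite !inE /= => /andP[/suppP eT _] /andP[/suppP eT' _].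
  rewrite /f /= => ee; have /rowP/(_ i) := ee.
  rewrite !mxE eT ?eT' ?inE ?eqxx // !addr0 => /(mulIf ci) aa.
  by move: ee; rewrite aa => /addrI ->.
apply: eq_card => e; apply/idP/imsetP.
  rewrite inE => /andP[eT /eqP He].
  (* The only multiple of [c] whose removal cancels the coordinate [i] of [e]. *)
  exists (e 0 i / c 0 i, e - (e 0 i / c 0 i) *: c); last by rewrite /f addrC subrK.
  rewrite !inE /=; apply/andP; split; last first.
    by rewrite addrC -scaleNr syndromeP Hc scaler0 add0r He.
  apply/suppP => j; rewrite !inE negb_and negbK => /orP[/eqP ->|jT].
    by rewrite !mxE divfK // subrr.
  have /suppP eT' := eT; have /suppP cT' := cT.
  by rewrite !mxE (eT' j) ?(cT' j) // mulr0 subr0.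
case=> -[a e']; rewrite !inE /= => /andP[/suppP eT /eqP He] ->.
rewrite /f /=; apply/andP; split; last first.
  by rewrite syndromeP Hc scaler0 add0r He.
have /suppP cT' := cT; apply/suppP => j jT.
by rewrite !mxE cT' // eT ?mulr0 ?add0r // !inE (negPf jT) andbF.
Qed.

Lemma nonblock_vanishing T (u : 'rV[K]_r) : #|T| = r -> T \notin B ->
  (forall i, i \in T -> (u *m H) 0 i = 0) -> u = 0.
Proof.
move=> cT TB uT; apply/rowP => j.
(* The syndrome of [e] is the [j]-th unit vector, so [u 0 j] is the product of [u *m H] with [e];
   this is zero because [u *m H] vanishes on [T]. *)
have [e eT He] := nonblock_span (delta_mx j 0) cT TB.
have := row_mul_supp eT uT; rewrite -mulmxA He -colE.
by move=> /matrixP/(_ 0 0); rewrite !mxE.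
Qed.

(** A zero set of more than [r] points contains an [(r-1)]-set [T1] and at least two further points.
    Only one point completes [T1] to a block, so the zero set contains a nonblock, whose columns
    span. *)
Lemma many_zeros_eq0 (u : 'rV[K]_r) :
  (r < #|[set i | (u *m H) 0%R i == 0%R]|)%N -> u = 0.
Proof.
set Z := [set i | _] => ltZ.
have [|T1 sT1 cT1] := @exists_subset_card _ Z r.-1.
  by rewrite (leq_trans (leq_pred _)) // ltnW.
have cT1' : #|T1|.+1 = r by rewrite cT1 prednK.
have : (#|extensions B T1| < #|Z :\: T1|)%N.
  rewrite (block_ext sc cT1') cardsD (setIidPr sT1) ltn_subRL addn1.
  by rewrite cT1'.
move=> lt_ext; have /subsetPn[i] : ~~ (Z :\: T1 \subset extensions B T1).
  by apply: contraTN lt_ext => /subset_leq_card; rewrite -leqNgt.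
rewrite !inE => /andP[iT iZ]; rewrite iT /= => iB.
apply: (nonblock_vanishing _ iB); first by rewrite cardsU1 iT.
move=> j; rewrite !inE => /orP[/eqP ->|/(subsetP sT1)]; first exact/eqP.
by rewrite inE => /eqP.
Qed.

Lemma syndrome_form_inj (u : 'rV[K]_r) : u *m H = 0 -> u = 0.
Proof.
move=> uH; apply: many_zeros_eq0.
by rewrite (eq_card (B := predT)) ?card_ord // => i; rewrite !inE uH mxE eqxx.
Qed.

End SteinerCircuits.

(** * Dimension and dual of the code with a given parity check matrix *)

Lemma has_min_dist_supp (K : finFieldType) n (C : {vspace 'rV[K]_n}) d :
  (exists c, [/\ c \in C, c != 0 & #|supp c| = d]) ->
  (forall c, c \in C -> c != 0 -> (d <= #|supp c|)%N) -> has_min_dist C d.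
Proof.
move=> [c [cC c0 cd]] min_d; split=> [|x y xC yC xy].
  by exists c, 0; rewrite hamming_distE subr0 mem0v.
by rewrite hamming_distE min_d ?memvB // subr_eq0.
Qed.

Lemma dim_null_code (K : finFieldType) r n (H : 'M[K]_(r, n)) :
  (forall s : 'cV[K]_r, exists e : 'rV_n, H *m e^T = s) ->
  (\dim (null_code H) + r)%N = n.
Proof.
move=> H_onto; pose f := linfun (mulmxr H^T : 'rV[K]_n -> 'rV[K]_r).
have limgf : limg f = fullv.
  apply/vspaceP => s; rewrite memvf; have [e He] := H_onto s^T.
  apply/memv_imgP; exists e; rewrite ?memvf // lfunE /=.
  by apply: trmx_inj; rewrite trmx_mul trmxK He.
have := limg_ker_dim f fullv; rewrite limgf capfv !dimvf /dim /= !mul1n.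
by [].
Qed.

Lemma mem_dual_null_code (K : finFieldType) r n (H : 'M[K]_(r, n)) (y : 'rV_n) :
  y \in dual_code (null_code H) <-> exists u, y = u *m H.
Proof.
split=> [/mem_dual_code yC|[u ->]]; last first.
  apply/mem_dual_code => x.
  rewrite mem_null_code => /eqP Hx.
  have : (u *m H *m x^T) 0 0 = 0 by rewrite -mulmxA Hx mulmx0 mxE.
  rewrite mxE => uHx; rewrite -[RHS]uHx.
  by apply: eq_bigr => i _; rewrite [x^T _ _]mxE mulrC.
suff /submxP[u ->] : (y <= H)%MS by exists u.
rewrite submxE; apply/eqP/matrixP => i j; rewrite !ord1 [RHS]mxE mxE.
(* The columns of [cokermx H] are codewords; orthogonality of [y] to them puts [y] in the row space
   of [H]. *)
have := yC (col j (cokermx H))^T; rewrite mem_null_code trmxK colE mulmxA.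
rewrite mulmx_coker mul0mx eqxx -colE => /(_ isT) yj; rewrite -[RHS]yj.
by apply: eq_bigr => l _; rewrite !mxE mulrC.
Qed.

Lemma dual_null_code (K : finFieldType) r n (H : 'M[K]_(r, n)) :
  dual_code (null_code H) = limg (linfun (mulmxr H : 'rV[K]_r -> 'rV[K]_n)).
Proof.
apply/vspaceP => y; apply/idP/memv_imgP => [/mem_dual_null_code[u ->]|[u _ ->]].
  by exists u; rewrite ?memvf // lfunE.
by apply/mem_dual_null_code; exists u; rewrite lfunE.
Qed.

Lemma dim_dual_null_code (K : finFieldType) r n (H : 'M[K]_(r, n)) :
  \dim (dual_code (null_code H)) = r <-> forall u : 'rV_r, u *m H = 0 -> u = 0.
Proof.
rewrite dual_null_code; set g := linfun _.
have := limg_ker_dim g fullv; rewrite capfv dimvf /dim /= mul1n => dim_g.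
split=> [dim_r u uH|H_inj].
  move/eqP: dim_g; rewrite dim_r -[X in _ == X]add0n eqn_add2r dimv_eq0 => /eqP ker0.
  by apply/eqP; rewrite -memv0 -ker0 memv_ker lfunE /= uH.
suff ker0 : lker g = 0%VS by rewrite ker0 dimv0 in dim_g.
apply/eqP; rewrite -subv0; apply/subvP => u.
by rewrite memv_ker lfunE /= memv0 => /eqP/H_inj ->.
Qed.

Lemma card_zeros (K : finFieldType) n (y : 'rV[K]_n) :
  (#|[set i | y 0%R i == 0%R]| + #|supp y|)%N = n.
Proof.
rewrite -[RHS](card_ord n) -(cardsC (supp y)) addnC; congr (_ + _)%N.
by apply: eq_card => i; rewrite !inE negbK.
Qed.

(** * NMDS property and covering radius of a Steiner code *)

Section SteinerCode.

Variables (K : finFieldType) (r n : nat) (H : 'M[K]_(r, n)).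
Variable B : {set {set 'I_n}}.
Hypotheses (sc : steiner_circuits H B) (r_gt0 : (0 < r)%N) (ltrn : (r < n)%N).

(** A block word has weight [r], and fewer than [r] columns are independent. Dually, a nonzero
    [v *m H] has at most [r = n - k] zeros by [many_zeros_eq0], and [u] shows that weight [k] is
    attained. *)
Lemma steiner_NMDS k : (r + k)%N = n ->
  (exists u : 'rV[K]_r, #|supp (u *m H)| = k) -> is_NMDS (null_code H) k.
Proof.
move=> rk [u uk].
have k_gt0 : (0 < k)%N by rewrite -(ltn_add2l r) addn0 rk.
have nk : (n - k)%N = r by rewrite -rk addnK.
rewrite /is_NMDS /is_code nk; split; split.
- apply/eqP; rewrite -(eqn_add2r r) dim_null_code ?[(k + _)%N]addnC ?rk //.
  exact: (syndrome_onto sc).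
- apply: has_min_dist_supp => [|c].
    have [T TB] := exists_block sc r_gt0 ltrn; have cT := block_card sc TB.
    have [c Hc scT] := block_word sc TB.
    exists c; split; rewrite ?mem_null_code ?Hc ?scT //.
    by rewrite -supp_eq0 scT -cards_eq0 cT -lt0n.
  rewrite mem_null_code => /eqP Hc; apply: contraNT; rewrite -ltnNge => lt_c.
  by apply/eqP/(few_columns_free sc).
- exact/dim_dual_null_code/(syndrome_form_inj sc).
apply: has_min_dist_supp => [|y /mem_dual_null_code[v ->]].
  exists (u *m H); split=> //; first by apply/mem_dual_null_code; exists u.
  by rewrite -supp_eq0 -cards_eq0 uk -lt0n.
apply: contraNT; rewrite -ltnNge => lt_v.
rewrite (@many_zeros_eq0 _ _ _ _ _ sc r_gt0 v) ?mul0mx //.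
have := card_zeros (v *m H); rewrite -[in RHS]rk => zE.
by rewrite -(ltn_add2r #|supp (v *m H)|) zE ltn_add2l.
Qed.

(** The columns of any nonblock span, so every syndrome is that of a vector of weight at most
    [r]. *)
Lemma covering_radius_le : (covering_radius (null_code H) <= r)%N.
Proof.
rewrite /covering_radius; case: ex_minnP => R _; apply.
apply/forallP => v; have [T cT TB] := exists_nonblock sc r_gt0 ltrn.
have [e eT He] := nonblock_span sc (H *m v^T) cT TB.
apply/existsP; exists (v - e); rewrite mem_null_code syndromeB He subrr eqxx /=.
by rewrite hamming_distE opprB addrC subrK -cT subset_leq_card.
Qed.

Lemma covering_radius_eq :
  covering_radius (null_code H) = r <->
  exists s : 'cV[K]_r, forall e : 'rV_n, H *m e^T = s -> (r <= #|supp e|)%N.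
Proof.
have leR := covering_radius_le; move: leR; rewrite /covering_radius.
case: ex_minnP => R covR minR leR; split=> [Rr|[s Hs]].
  have : ~~ covers (null_code H) r.-1.
    by apply/negP => /minR; rewrite Rr -ltnS prednK ?ltnn.
  case/forallPn => v /existsPn nv; exists (H *m v^T) => e He.
  have := nv (v - e); rewrite mem_null_code syndromeB He subrr eqxx /=.
  by rewrite hamming_distE opprB addrC subrK -ltnNge prednK.
apply/eqP; rewrite eqn_leq leR /=.
have [v Hv] := syndrome_onto sc r_gt0 ltrn s.
have /forallP/(_ v)/existsP[c /andP[]] := covR.
rewrite mem_null_code hamming_distE => /eqP Hc; apply: leq_trans.
by apply: Hs; rewrite syndromeB Hv Hc subr0.
Qed.

End SteinerCode.

(** * Double counting over blocks, faces and weights *)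

Lemma sum_block_faces n (B : {set {set 'I_n}}) r (g : {set 'I_n} -> nat) :
  (forall T, T \in B -> #|T| = r) ->
  (\sum_(T in B) \sum_(i in T) g (T :\ i)
    = \sum_(T : {set 'I_n} | #|T|.+1 == r) #|extensions B T| * g T)%N.
Proof.
move=> cB; rewrite (exchange_big_dep xpredT) //=.
under [RHS]eq_bigr do rewrite -sum_nat_const.
rewrite [RHS](exchange_big_dep xpredT) //=; apply: eq_bigr => i _.
(* A pair of a block and a point [i] in it is recorded by the face left on removing [i]; a face [T]
   arises once for each [i] in [extensions B T]. *)
rewrite (reindex_onto (fun T => i |: T) (fun T => T :\ i)) /=; last first.
  move=> T /andP[_ iT].
  exact: setD1K.
have cond T : (i |: T \in B) && (i \in i |: T) && ((i |: T) :\ i == T)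
    = (#|T|.+1 == r) && (i \in extensions B T).
  rewrite !inE eqxx andbT /=; case: (boolP (i \in T)) => iT /=.
    rewrite andbF; apply/negP => /andP[_ /eqP/setP/(_ i)].
    by rewrite !inE eqxx iT.
  rewrite setU1K // eqxx andbT.
  case: (boolP (_ \in B)) => [/cB <-|]; rewrite ?andbF //.
  by rewrite cardsU1 iT eqxx.
apply: eq_big => T; first exact: cond.
by rewrite cond inE => /andP[_ /andP[iT _]]; rewrite setU1K.
Qed.

Lemma sum_card_solutions (K : finFieldType) r n (H : 'M[K]_(r, n)) (s : 'cV_r) t :
  (t <= n)%N ->
  (\sum_(T : {set 'I_n} | #|T| == t) #|solutions H s T|
   = \sum_(j < n.+1) #|[set e : 'rV_n | (H *m e^T == s) && (#|supp e| == j)]|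
                     * 'C(n - j, n - t))%N.
Proof.
move=> letn; under eq_bigr do rewrite -sum1dep_card.
rewrite (exchange_big_dep (fun e : 'rV_n => H *m e^T == s)) /=; last first.
  by move=> T e _ /andP[].
(* Weights are at most [n], so [inord] does not fall back on its default value. *)
rewrite (partition_big (fun e : 'rV_n => inord #|supp e| : 'I_n.+1) xpredT) //=.
apply: eq_bigr => j _; rewrite -sum1dep_card big_distrl /=.
have suppE (e : 'rV[K]_n) : (inord #|supp e| == j :> 'I_n.+1) = (#|supp e| == j).
  rewrite -val_eqE /= inordK // ltnS.
  by rewrite (leq_trans (max_card _)) // card_ord.
apply: eq_big => e; first by rewrite suppE.
rewrite suppE mul1n => /andP[/eqP He /eqP <-].
have := @card_supersets _ (supp e) t; rewrite card_ord => /(_ letn) <-.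
rewrite sum1dep_card.
by apply: eq_card => T; rewrite !inE He eqxx andbT.
Qed.

Lemma dist_count_syndrome (K : finFieldType) r n (H : 'M[K]_(r, n)) (v : 'rV_n) j :
  dist_count v (null_code H) j
  = #|[set e : 'rV_n | (H *m e^T == H *m v^T) && (#|supp e| == j)]|.
Proof.
pose f (e : 'rV[K]_n) := v - e; have fK : involutive f by exact: subKr.
rewrite /dist_count -(card_imset _ (inv_inj fK)).
apply: eq_card => e; rewrite -[e in LHS]fK (mem_imset _ _ (inv_inj fK)) !inE /f.
rewrite mem_null_code hamming_distE subKr syndromeB subr_eq0.
by rewrite [LHS]andbC [RHS]andbC [X in _ && X]eq_sym.
Qed.

(** * Uniform packing *)

Section SteinerPacking.

Variables (K : finFieldType) (r n : nat) (H : 'M[K]_(r, n)).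
Variable B : {set {set 'I_n}}.
Hypotheses (sc : steiner_circuits H B) (r_gt0 : (0 < r)%N) (ltrn : (r < n)%N).

Definition nonblocks : {set {set 'I_n}} :=
  [set T : {set 'I_n} | (#|T| == r) && (T \notin B)].

Lemma nonblocks_gt0 : (0 < #|nonblocks|)%N.
Proof.
have [T cT TB] := exists_nonblock sc r_gt0 ltrn.
by apply/card_gt0P; exists T; rewrite inE cT eqxx.
Qed.

Lemma solutions_balance (s : 'cV[K]_r) :
  (r * \sum_(T : {set 'I_n} | #|T| == r) #|solutions H s T|
   = r * #|nonblocks| +
     #|K| * \sum_(T : {set 'I_n} | #|T| == r.-1) #|solutions H s T|)%N.
Proof.
rewrite (bigID (fun T => T \in B)) /= mulnDr addnC; congr (_ + _)%N.
  congr (_ * _)%N; rewrite -sum1dep_card; apply: eq_bigr => T /andP[/eqP cT TB].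
  exact: (card_solutions_nonblock sc).
have -> : (\sum_(T : {set 'I_n} | (#|T| == r) && (T \in B)) #|solutions H s T|
           = \sum_(T in B) #|solutions H s T|)%N.
  apply: eq_bigl => T; case: (boolP (T \in B)) => [/(block_card sc) ->|].
    by rewrite eqxx.
  by rewrite andbF.
transitivity (#|K| * \sum_(T in B) \sum_(i in T) #|solutions H s (T :\ i)|)%N.
  rewrite !big_distrr; apply: eq_bigr => T TB /=.
  rewrite -{1}(block_card sc TB) -sum_nat_const big_distrr.
  by apply: eq_bigr => i iT; apply: (card_solutions_block sc).
rewrite (sum_block_faces (fun T => #|solutions H s T|) (block_card sc)).
congr (_ * _)%N; apply: eq_big => T.
  by rewrite -[in LHS](prednK r_gt0) eqSS.
by move=> /eqP cT; rewrite (block_ext sc cT) mul1n.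
Qed.

Lemma steiner_UPWS :
  covering_radius (null_code H) = r -> is_UPWS (null_code H).
Proof.
move=> Rr.
pose b j : rat :=
  r%:R * 'C(n - j, n - r)%:R - #|K|%:R * 'C(n - j, n - r.-1)%:R.
(* The constant term of [solutions_balance]; dividing by it normalises the relation to 1, and it is
   nonzero because a nonblock exists. *)
pose N : rat := r%:R * #|nonblocks|%:R.
have N0 : N != 0.
  by rewrite mulf_neq0 // Num.Theory.pnatr_eq0 -lt0n // nonblocks_gt0.
exists (fun j => b j / N) => v.
rewrite -(big_mkord xpredT (fun j => b j / N * (dist_count v (null_code H) j)%:R)) Rr.
(* For [j > r] both binomials in [b j] vanish, since [n - j < n - r]; the sum may thus run over all
   weights up to [n], as in [sum_card_solutions]. *)
have -> : \sum_(0 <= j < r.+1) b j / N * (dist_count v (null_code H) j)%:R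
        = \sum_(0 <= j < n.+1) b j / N * (dist_count v (null_code H) j)%:R.
  rewrite [RHS](big_cat_nat (n := r.+1)) ?ltnS ?(ltnW ltrn) //=.
  rewrite [X in _ + X]big1_seq ?addr0 // => j.
  rewrite mem_index_iota => /and3P[_ ltrj lejn].
  rewrite /b !bin_small ?mulr0 ?subr0 ?mul0r // ltn_sub2l ?(leq_ltn_trans (leq_pred r)) //.
apply: (mulfI N0); rewrite mulr1 big_distrr /= big_mkord.
have bal := solutions_balance (H *m v^T).
rewrite !sum_card_solutions ?(leq_trans (leq_pred _)) // ?(ltnW ltrn) // in bal.
move/(congr1 (fun x => x%:R : rat)): bal; rewrite natrD !natrM !natr_sum -/N.
move/eqP; rewrite -subr_eq => /eqP bal; rewrite -[RHS]bal !mulr_sumr -sumrB.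
apply: eq_bigr => j _; rewrite dist_count_syndrome /b !natrM.
rewrite [LHS]mulrA [N * _]mulrC divfK // mulrBl.
by congr (_ - _); rewrite -mulrA; congr (_ * _); apply: mulrC.
Qed.

End SteinerPacking.

(** * From the extremal weight count to a Steiner system *)

Section ExtremalNMDS.

Variables (F : finFieldType) (r n k : nat) (H : 'M[F]_(r, n)).
Hypotheses (r_gt0 : (0 < r)%N) (rk : (r + k)%N = n).
Hypothesis min_dist : forall c : 'rV_n, H *m c^T = 0 -> c != 0 -> (r <= #|supp c|)%N.
Hypothesis min_dual : forall u : 'rV_r, u != 0 -> (k <= #|supp (u *m H)|)%N.

Definition min_words : {set 'rV[F]_n} :=
  [set c | (H *m c^T == 0) && (#|supp c| == r)].

Definition min_supports : {set {set 'I_n}} := [set supp c | c in min_words].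

(** Two minimum words with equal support are proportional: subtracting the multiple that cancels one
    coordinate leaves a word of weight below [r]. *)
Lemma min_words_fiber (T : {set 'I_n}) : T \in min_supports ->
  #|[set c in min_words | supp c == T]| = #|F|.-1.
Proof.
case/imsetP => c; rewrite inE => /andP[/eqP Hc /eqP cr] ->.
have [i ic] : exists i, i \in supp c by apply/card_gt0P; rewrite cr.
have ci : c 0 i != 0 by move: ic; rewrite inE.
have c0 : c != 0 by rewrite -supp_eq0 -cards_eq0 cr -lt0n.
rewrite -(cardsC1 0) -(card_imset _ (_ : injective (fun a : F => a *: c))); last first.
  move=> a b /eqP; rewrite -subr_eq0 -scalerBl scaler_eq0 (negPf c0) orbF.
  by rewrite subr_eq0 => /eqP.
apply: eq_card => e; apply/idP/imsetP => [|[a]]; last first.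
  rewrite !inE => a0 ->; rewrite suppZ // cr !eqxx !andbT.
  by rewrite -[a *: c]addr0 syndromeP Hc trmx0 mulmx0 scaler0 addr0.
rewrite !inE => /andP[/andP[/eqP He _] /eqP ec]; exists (e 0 i / c 0 i).
  by rewrite !inE mulf_neq0 ?invr_eq0 //; move: ic; rewrite -ec inE.
apply/eqP; rewrite -subr_eq0; set d := e - _.
have Hd : H *m d^T = 0.
  by rewrite /d addrC -scaleNr syndromeP Hc He scaler0 addr0.
apply: contraT => d0; have := min_dist Hd d0; rewrite leqNgt; case/negP.
rewrite -cr (cardsD1 i (supp c)) ic add1n ltnS subset_leq_card //.
apply/suppP => j; rewrite in_setD1 negb_and negbK => /orP[/eqP ->|jc].
  by rewrite !mxE divfK // subrr.
have /suppP/(_ j jc) cj := subxx (supp c).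
have /suppP/(_ j) ej := subxx (supp e).
by rewrite !mxE cj ej ?ec // mulr0 subr0.
Qed.

Lemma card_min_words : #|min_words| = (#|min_supports| * #|F|.-1)%N.
Proof.
rewrite -sum1_card (partition_big (@supp F n) (mem min_supports)) /=; last first.
  by move=> c cW; apply: imset_f.
rewrite -sum_nat_const; apply: eq_bigr => T TB.
by rewrite sum1dep_card min_words_fiber.
Qed.

Lemma min_supports_card (T : {set 'I_n}) : T \in min_supports -> #|T| = r.
Proof. by case/imsetP => c; rewrite inE => /andP[_ /eqP cr] ->. Qed.

Lemma min_supports_word (T : {set 'I_n}) : T \in min_supports ->
  exists2 c, H *m c^T = 0 & supp c = T.
Proof. by case/imsetP => c; rewrite inE => /andP[/eqP Hc _] ->; exists c. Qed.

(* A hyperplane through the columns indexed by T contains the column of every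
   extension of T, but at most r columns in all since the dual distance is k. *)
Lemma extensions_le1 (T : {set 'I_n}) : #|T|.+1 = r ->
  (#|extensions min_supports T| <= 1)%N.
Proof.
move=> cT; apply/card_le1_eqP => i j; rewrite !inE => /andP[iT iB] /andP[jT jB].
have [|u u0 uT] := @exists_vanishing _ _ _ H T; first by rewrite cT.
have u_ext l : l \notin T -> l |: T \in min_supports -> (u *m H) 0 l = 0.
  move=> lT /min_supports_word[c Hc scl].
  have cE m : (c 0 m != 0) = (m \in l |: T) by rewrite -scl inE.
  apply: (vanishing_coord (c := c)); rewrite -?mulmxA ?Hc ?mulmx0 ?cE ?setU11 // => m.
  by rewrite cE in_setU1 => /orP[/eqP ->|/uT //]; rewrite eqxx.
apply/eqP; apply: contraT => ij.
have : (#|supp (u *m H)| < k)%N.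
  have := card_zeros (u *m H); rewrite -[in RHS]rk => zE.
  rewrite -(ltn_add2l r) -zE ltn_add2r.
  have <- : #|j |: (i |: T)| = r.+1.
    by rewrite !cardsU1 iT add1n cT !inE negb_or jT andbT ij add1n.
  apply: subset_leq_card; apply/subsetP => l; rewrite !inE.
  by case/or3P => [/eqP ->|/eqP ->|/uT ->]; rewrite ?u_ext ?eqxx.
by rewrite ltnNge min_dual.
Qed.

(** An averaging argument: the extension numbers of the [(r-1)]-sets sum to [r] times the number of
    blocks, which extremality makes equal to the number of [(r-1)]-sets. As each is at most 1, all
    equal 1. *)
Lemma extremal_steiner :
  (r * #|min_words|)%N = ('C(n, k.+1) * #|F|.-1)%N -> steiner_circuits H min_supports.
Proof.
move=> extr; have q1 : (0 < #|F|.-1)%N.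
  by rewrite -ltnS prednK ?finNzRing_gt1 // ltnW ?finNzRing_gt1.
have {extr} cB : (r * #|min_supports|)%N = 'C(n, r.-1).
  move/eqP: extr; rewrite card_min_words mulnA eqn_pmul2r // => /eqP ->.
  (* Symmetry of binomials turns ['C(n, k.+1)] into the number of [(r-1)]-sets. *)
  have -> : (r.-1 = n - k.+1)%N by rewrite -rk subnS addnK.
  by rewrite bin_sub // -rk -[k.+1]add1n leq_add2r.
have sum_ext : (\sum_(T : {set 'I_n} | #|T|.+1 == r) #|extensions min_supports T|
    = \sum_(T : {set 'I_n} | #|T|.+1 == r) 1)%N.
  transitivity 'C(n, r.-1).
    rewrite -cB mulnC -sum_nat_const.
    transitivity (\sum_(T : {set 'I_n} | #|T|.+1 == r) #|extensions min_supports T| * 1)%N.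
      by apply: eq_bigr => T _; rewrite muln1.
    rewrite -(sum_block_faces (fun=> 1%N) min_supports_card).
    by apply: eq_bigr => T TB; rewrite sum1_card min_supports_card.
  rewrite sum1dep_card -[in LHS](card_ord n) -card_draws.
  by apply: eq_card => T; rewrite !inE -[in RHS](prednK r_gt0) eqSS.
split.
- exact: min_supports_card.
- exact: min_supports_word.
- move=> T cT TB e eT He; apply: contraNeq TB => e0; apply/imsetP; exists e.
    rewrite inE He eqxx eqn_leq min_dist // andbT /=.
    by rewrite -cT subset_leq_card.
  by apply/eqP; rewrite eq_sym eqEcard eT cT min_dist.
move=> T cT.
have := @leqif_sum _ (fun T : {set 'I_n} => #|T|.+1 == r)
  (fun T => #|extensions min_supports T| == 1%N)
  (fun T => #|extensions min_supports T|) (fun=> 1%N).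
case=> [S /eqP cS|_]; first by apply/leqif_eq/extensions_le1.
by rewrite sum_ext eqxx => /esym/forallP/(_ T); rewrite cT eqxx => /eqP.
Qed.

End ExtremalNMDS.

(** * Field extensions *)

Lemma exists_free_family (F L : finFieldType) (iota : {rmorphism F -> L}) d :
  (#|F| ^ d <= #|L|)%N ->
  exists b : 'cV[L]_d, forall x : 'rV[F]_d, map_mx iota x *m b = 0 -> x = 0.
Proof.
elim: d => [|d IHd] le_dL; first by exists 0 => x _; rewrite thinmx0.
have q_gt1 := finNzRing_gt1 F.
have [|b b_free] := IHd; first by rewrite (leq_trans _ le_dL) // leq_exp2l.
pose f (x : 'rV[F]_d) := (map_mx iota x *m b) 0 0.
(* The span of [b] over [F] has at most [#|F| ^ d < #|L|] elements, so some [z] lies outside it and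
   extends the free family. *)
have [z zf] : exists z, z \notin codom f.
  apply/existsP; rewrite -negb_forall; apply: contraTN le_dL => /forallP f_onto.
  rewrite -ltnNge (@leq_ltn_trans (#|F| ^ d)) ?ltn_exp2l //.
  rewrite -[d in X in (_ <= X)%N]mul1n -card_mx.
  apply: leq_trans (leq_image_card f _); apply/subset_leq_card/subsetP => z _.
  exact: f_onto.
suff zb_free (y : 'rV_1) (w : 'rV_d) :
    map_mx iota (row_mx y w) *m col_mx z%:M b = 0 -> row_mx y w = 0.
  exists (col_mx (z%:M : 'M_1) b) => x.
  by rewrite -[x](@hsubmxK _ 1 1 d); apply: zb_free.
rewrite map_row_mx mul_row_col => zb.
have y0 : y = 0.
  apply/eqP; apply: contraNT zf => y0; apply/codomP; exists (- (y 0 0)^-1 *: w).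
  have y00 : iota (y 0 0) != 0.
    rewrite fmorph_eq0; apply: contraNneq y0 => y0.
    by apply/eqP/rowP => i; rewrite !ord1 y0 mxE.
  have /matrixP/(_ 0 0) := zb; rewrite mul_mx_scalar !mxE => /(canRL (addrK _)).
  rewrite add0r => /(canRL (mulfK y00)) ->.
  rewrite /f map_mxZ -scalemxAl [RHS]mxE rmorphN fmorphV !mulNr mulrC [in RHS]mxE.
  by rewrite mulrC.
move: zb; rewrite y0 map_mx0 mul0mx add0r => /b_free ->.
by rewrite row_mx0.
Qed.

Lemma map_mx_syndrome (F L : finFieldType) (iota : {rmorphism F -> L}) r n
    (H : 'M[F]_(r, n)) (c : 'rV_n) :
  map_mx iota H *m (map_mx iota c)^T = map_mx iota (H *m c^T).
Proof. by rewrite map_mxM map_trmx. Qed.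

Lemma supp_map_mx (F L : finFieldType) (iota : {rmorphism F -> L}) n (c : 'rV_n) :
  supp (map_mx iota c) = supp c.
Proof. by apply/setP => i; rewrite !inE mxE fmorph_eq0. Qed.

(** Block words map to block words with the same support. Freeness on a nonblock is an inclusion of
    kernels of matrices over [F], and such inclusions persist over [L]. *)
Lemma steiner_lift (F L : finFieldType) (iota : {rmorphism F -> L}) r n
    (H : 'M[F]_(r, n)) B :
  steiner_circuits H B -> steiner_circuits (map_mx iota H) B.
Proof.
case=> cB wB freeB extB; split=> // [T /wB[c Hc cT]|T cT TB e eT He].
  by exists (map_mx iota c); rewrite ?supp_map_mx // map_mx_syndrome Hc map_mx0.
pose D : 'M[F]_n := diag_mx (\row_i (i \in T)%:R).
have mulD (K : finFieldType) (x : 'rV[K]_n) i :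
    (x *m diag_mx (\row_i (i \in T)%:R)) 0 i = x 0 i * (i \in T)%:R.
  by rewrite mul_mx_diag !mxE.
have kerD : (kermx (D *m H^T) <= kermx D)%MS.
  apply/rV_subP => x /sub_kermxP; rewrite mulmxA => xDH; apply/sub_kermxP.
  apply: (freeB T cT TB).
    by apply/suppP => i iT; rewrite mulD (negPf iT) mulr0.
  by apply: trmx_inj; rewrite trmx_mul trmxK xDH trmx0.
have mapD : map_mx iota D = diag_mx (\row_i (i \in T)%:R).
  by rewrite map_diag_mx; congr diag_mx; apply/rowP => i; rewrite !mxE rmorph_nat.
have eD : e *m map_mx iota D = e.
  have /suppP eT' := eT; apply/rowP => i; rewrite mapD mulD.
  by case: (boolP (i \in T)) => [|/eT' ->]; rewrite ?mulr1 ?mul0r.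
rewrite -(map_submx iota) !map_kermx map_mxM in kerD.
rewrite -eD; apply/sub_kermxP; apply: submx_trans kerD; apply/sub_kermxP.
rewrite mulmxA eD -map_trmx; apply: trmx_inj.
by rewrite trmx_mul trmxK He trmx0.
Qed.

(* Full covering radius is expressed through hyperplanes defined over F, so it
   depends on the extension L only through its dimension over F. *)
Lemma covering_radius_lift_eq (F L : finFieldType) (iota : {rmorphism F -> L}) r n
    (H : 'M[F]_(r, n)) B :
  steiner_circuits H B -> (0 < r)%N -> (r < n)%N ->
  covering_radius (null_code (map_mx iota H)) = r <->
  exists s : 'cV[L]_r, forall u : 'rV[F]_r, u != 0 ->
    (r <= #|[set i | (u *m H) 0%R i == 0%R]|.+1)%N -> map_mx iota u *m s != 0.
Proof.
move=> sc r_gt0 ltrn; have scL := steiner_lift iota sc.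
split=> [/(covering_radius_eq scL r_gt0 ltrn)[s s_far]|[s s_off]].
  exists s => u u0 uZ; apply/eqP => us.
  (* Take [r - 1] zeros of [u *m H] and a nonblock [i |: T]. The vector [e] on it with syndrome [s]
     has weight [r], so [e 0 i] is nonzero; then [us] forces [u *m H] to vanish at [i] too, hence on
     a nonblock, and [u] would be zero. *)
  have [|T TZ cT] := @exists_subset_card _ [set i | (u *m H) 0 i == 0] r.-1.
    by rewrite -ltnS prednK.
  have cT' : #|T|.+1 = r by rewrite cT prednK.
  have [i iT iB] := exists_nonblock_ext sc ltrn cT'.
  have ciT : #|i |: T| = r by rewrite cardsU1 iT add1n.
  have [e eT He] := nonblock_span scL s ciT iB.
  have uT j : j \in T -> (u *m H) 0 j = 0 by move/(subsetP TZ); rewrite inE => /eqP.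
  have /suppP eT' := eT.
  have : e 0 i != 0.
    apply: contraTN (s_far e He) => /eqP ei; rewrite -ltnNge -cT' ltnS.
    apply/subset_leq_card/suppP => j jT.
    have [-> //|ji] := eqVneq j i; apply: eT'.
    by rewrite !inE negb_or ji.
  move=> ei; have : (map_mx iota (u *m H)) 0 i = 0.
    apply: (vanishing_coord (c := e)) => // [|j ej ji].
      by rewrite map_mxM -mulmxA He.
    rewrite mxE uT ?rmorph0 //; apply: contraNT ej => jT.
    by rewrite eT' // !inE negb_or ji.
  rewrite mxE => /eqP; rewrite fmorph_eq0 => /eqP ui.
  move/eqP: u0; apply; apply: (nonblock_vanishing sc ciT iB) => j.
  by rewrite in_setU1 => /orP[/eqP ->|/uT].
apply/(covering_radius_eq scL r_gt0 ltrn); exists s => e He.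
rewrite leqNgt; apply/negP => lt_e.
(* If [e] had weight below [r], a hyperplane over [F] through [r - 1] columns containing its support
   would contain [s]. *)
have [||T eT cT] := @exists_superset_card _ (supp e) r.-1.
- by rewrite -ltnS prednK.
- by rewrite card_ord (leq_trans (leq_pred _)) // ltnW.
have [|u u0 uT] := @exists_vanishing _ _ _ H T; first by rewrite cT prednK.
suff us : map_mx iota u *m s = 0.
  have := s_off u u0; rewrite us eqxx => /(_ _)/notF; apply.
  apply: (@leq_trans #|T|.+1); first by rewrite cT prednK.
  rewrite ltnS; apply/subset_leq_card/subsetP => i /uT ui.
  by rewrite inE ui.
rewrite -He mulmxA -map_mxM; apply: (row_mul_supp eT) => i /uT ui.
by rewrite mxE ui rmorph0.
Qed.

Lemma natr_card_finField (F : finFieldType) : #|F|%:R = 0 :> F.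
Proof.
have := expg_cardG (in_setT (1 : F)).
by rewrite cardsT FinRing.zmodXgE.
Qed.

(* The splitting field of X^(q^m) - X, whose roots are the fixed points of the
   m-th power of the Frobenius map over F. *)
Lemma exists_extension (F : finFieldType) m : (0 < m)%N ->
  exists (L : finFieldType) (iota : {rmorphism F -> L}), #|L| = (#|F| ^ m)%N.
Proof.
move=> m_gt0; set Q := (#|F| ^ m)%N; have q_gt1 := finNzRing_gt1 F.
have Q_gt1 : (1 < Q)%N by rewrite (ltn_exp2l 0).
pose g (R : nzRingType) : {poly R} := 'X^Q - 'X.
have sz_g (R : nzRingType) : size (g R) = Q.+1.
  by rewrite size_polyDl size_polyXn // size_polyN size_polyX.
have /FinSplittingFieldFor[/= L splitL] : g F != 0.
  by rewrite -size_poly_eq0 sz_g.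
rewrite [map_poly _ _]rmorphB rmorphXn /= map_polyX -/(g L) in splitL.
pose Lm := FinFieldExtType L; exists Lm, (in_alg L).
(* [a] is the Frobenius map [x ^+ #|F|]. *)
have /finField_galois_generator[/= a _ Da] : (1 <= {:L})%VS by apply: sub1v.
pose E := fixedSpace (a ^+ m)%g; rewrite dimv1 expn1 in Da.
have {splitL} [zs Dg defL] := splitL.
have Q0 : Q%:R = 0 :> L.
  by rewrite natrX -(rmorph_nat (in_alg L)) natr_card_finField rmorph0 expr0n gtn_eqF.
(* The derivative of the polynomial is -1 because [Q] is zero in [L]; hence it has [Q] distinct
   roots. *)
have Uzs : uniq zs.
  rewrite -separable_prod_XsubC -(eqp_separable Dg) unlock /g.
  have -> : ('X^Q - 'X : {poly L})^`() = -1.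
    by rewrite derivB derivXn derivX -mulr_natl -polyC_natr Q0 polyC0 mul0r sub0r.
  by rewrite -[-1]scaleN1r coprimepZr ?oppr_eq0 ?oner_eq0 // coprimep1.
suffices /eq_card -> : Lm =i zs.
  apply: succn_inj; rewrite (card_uniqP _) //= -(size_prod_XsubC _ id).
  by rewrite -(eqp_size Dg) sz_g.
have in_zs : zs =i E.
  move=> z; rewrite -root_prod_XsubC -(eqp_root Dg) (sameP fixedSpaceP eqP).
  rewrite /root !hornerE subr_eq0 /= /Q; congr (_ == z).
  elim: (m) => [|i IHi]; first by rewrite gal_id.
  by rewrite expgSr expnSr exprM IHi galM ?Da ?memvf.
(* The roots form the fixed field [E], and they generate [L]. *)
suffices defE : E = {:L}%VS by move=> z; rewrite in_zs defE memvf.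
apply/eqP; rewrite eqEsubv subvf -defL -[E]subfield_closed agenvS //.
by rewrite subv_add sub1v; apply/span_subvP => z; rewrite in_zs.
Qed.

Lemma covering_radius_large_degree (F L : finFieldType) (iota : {rmorphism F -> L})
    r n (H : 'M[F]_(r, n)) B m :
  steiner_circuits H B -> (0 < r)%N -> (r < n)%N ->
  #|L| = (#|F| ^ m)%N -> (r <= m)%N ->
  covering_radius (null_code (map_mx iota H)) = r.
Proof.
move=> sc r_gt0 ltrn cL lerm; apply/(covering_radius_lift_eq iota sc r_gt0 ltrn).
have [|b b_free] := @exists_free_family F L iota r.
  by rewrite cL leq_pexp2l // ltnW // finNzRing_gt1.
by exists b => u u0 _; apply: contraNneq u0 => /b_free ->.
Qed.

(** [L] need not contain [L']: the good [s'] is written in coordinates over an [F]-basis [b'] of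
    [L'], and the same coordinates are used with a free family [b] of [L]. A relation [u *m X = 0]
    over [F] then reads the same in both fields. *)
Lemma covering_radius_mono_degree (F L' L : finFieldType)
    (iota' : {rmorphism F -> L'}) (iota : {rmorphism F -> L})
    r n (H : 'M[F]_(r, n)) B m' m :
  steiner_circuits H B -> (0 < r)%N -> (r < n)%N ->
  #|L'| = (#|F| ^ m')%N -> #|L| = (#|F| ^ m)%N -> (m' <= m)%N ->
  covering_radius (null_code (map_mx iota' H)) = r ->
  covering_radius (null_code (map_mx iota H)) = r.
Proof.
move=> sc r_gt0 ltrn cL' cL lem.
move/(covering_radius_lift_eq iota' sc r_gt0 ltrn) => [s' s'_off].
apply/(covering_radius_lift_eq iota sc r_gt0 ltrn).
have [|b' b'_free] := @exists_free_family F L' iota' m'; first by rewrite cL'.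
have [|b b_free] := @exists_free_family F L iota m'.
  by rewrite cL leq_pexp2l // ltnW // finNzRing_gt1.
pose f (x : 'rV[F]_m') := (map_mx iota' x *m b') 0 0.
have f_inj : injective f.
  move=> x y fxy; apply/eqP; rewrite -subr_eq0; apply/eqP/b'_free/rowP => i.
  rewrite !ord1 map_mxB mulmxBl [LHS]mxE [X in _ + X]mxE [RHS]mxE.
  by rewrite -/(f x) fxy subrr.
(* A free family of [m'] elements is a basis of [L'], by cardinality. *)
have f_onto z : z \in codom f by apply: inj_card_onto; rewrite ?card_mx ?mul1n ?cL'.
pose X : 'M[F]_(r, m') := \matrix_i iinv (f_onto (s' i 0)).
have s'E : s' = map_mx iota' X *m b'.
  apply/colP => i; have := f_iinv (f_onto (s' i 0)); rewrite /f => <-.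
  by rewrite !mxE; apply: eq_bigr => j _; rewrite !mxE.
exists (map_mx iota X *m b) => u u0 uZ; apply: contraNneq (s'_off u u0 uZ).
rewrite mulmxA -map_mxM => /b_free uX.
by rewrite s'E mulmxA -map_mxM uX map_mx0 mul0mx.
Qed.

(** * Application to the given code and its lifts *)

Lemma extremal_NMDS_steiner (F : finFieldType) n k (C : {vspace 'rV[F]_n})
    (H : 'M[F]_(n - k, n)) :
  parity_check_matrix H C -> is_NMDS C k ->
  ((n - k) * weight_count C (n - k) = 'C(n, k.+1) * #|F|.-1)%N ->
  [/\ exists B, steiner_circuits H B, (0 < n - k)%N, (0 < k)%N, (n - k + k)%N = n &
      exists u : 'rV_(n - k), #|supp (u *m H)| = k].
Proof.
move=> hH [[dimC [[x [y [xC yC xy xyd]]] minC]] [dimD [dualD minD]]] extr.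
have [x' [y' [x'C y'C xy' xyd']]] := dualD.
have CE : C = null_code H by apply/vspaceP => c; rewrite hH mem_null_code.
have r_gt0 : (0 < n - k)%N.
  by rewrite -xyd hamming_distE lt0n cards_eq0 supp_eq0 subr_eq0.
have k_gt0 : (0 < k)%N.
  by rewrite -xyd' hamming_distE lt0n cards_eq0 supp_eq0 subr_eq0.
have rk : (n - k + k)%N = n by rewrite subnK // ltnW // -subn_gt0.
have min_dist c : H *m c^T = 0 -> c != 0 -> (n - k <= #|supp c|)%N.
  move=> Hc c0; rewrite -[c]subr0 -hamming_distE minC ?mem0v //.
  by rewrite hH Hc.
have H_inj : forall u : 'rV_(n - k), u *m H = 0 -> u = 0.
  by apply/dim_dual_null_code; rewrite -CE.
have min_dual (u : 'rV_(n - k)) : u != 0 -> (k <= #|supp (u *m H)|)%N.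
  move=> u0; rewrite -[u *m H]subr0 -hamming_distE minD ?mem0v //.
    by rewrite CE; apply/mem_dual_null_code; exists u.
  by apply: contraNneq u0 => /H_inj ->.
split=> //; last first.
  (* The difference of two dual words at distance [k] is a dual word of weight exactly [k]. *)
  have : x' - y' \in dual_code (null_code H) by rewrite -CE memvB.
  by case/mem_dual_null_code => u uE; exists u; rewrite -uE -hamming_distE.
exists (min_supports H); apply: (@extremal_steiner _ _ _ k) => //.
rewrite -extr; congr (_ * _)%N; apply: eq_card => c.
by rewrite !inE hH.
Qed.

Theorem theorem3p8 (F : finFieldType) (q n k R1 : nat)
    (C1 : {vspace 'rV[F]_n}) (H : 'M[F]_(n - k, n))
    (hq : #|F| = q)
    (hH : parity_check_matrix H C1)
    (hC1 : is_codeR C1 k (n - k) R1)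
    (hNMDS : is_NMDS C1 k)
    (hA : (weight_count C1 (n - k))%:R
            = 'C(n, k.+1)%:R * ((q%:R - 1) / (n - k)%:R) :> rat) :
  (forall m : nat, (n - k <= m)%N ->
     (exists (L : finFieldType) (iota : {rmorphism F -> L}),
        #|L| = (q ^ m)%N) /\
     (forall (L : finFieldType) (iota : {rmorphism F -> L}),
        #|L| = (q ^ m)%N ->
        [/\ covering_radius (lifted_code iota H) = (n - k)%N,
            is_UPWS (lifted_code iota H)
          & is_NMDS (lifted_code iota H) k]))
  /\
  (forall (m' : nat) (L' : finFieldType) (iota' : {rmorphism F -> L'}),
     (0 < m')%N -> (m' < n - k)%N -> #|L'| = (q ^ m')%N ->
     covering_radius (lifted_code iota' H) = (n - k)%N ->
     forall m : nat, (m' <= m)%N ->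
     forall (L : finFieldType) (iota : {rmorphism F -> L}),
       #|L| = (q ^ m)%N ->
       [/\ covering_radius (lifted_code iota H) = (n - k)%N,
           is_UPWS (lifted_code iota H)
         & is_NMDS (lifted_code iota H) k]).
Proof.
have r_gt0 : (0 < n - k)%N.
  have [[_ [[x [y [_ _ xy <-]]] _]] _] := hNMDS.
  by rewrite hamming_distE lt0n cards_eq0 supp_eq0 subr_eq0.
(* The rational hypothesis, cleared of its denominator; [q - 1] becomes the predecessor of
   [#|F|]. *)
have extr : ((n - k) * weight_count C1 (n - k) = 'C(n, k.+1) * #|F|.-1)%N.
  apply/eqP; rewrite -(Num.Theory.eqr_nat rat) !natrM hA -hq; apply/eqP.
  have r0 : (n - k)%:R != 0 :> rat by rewrite Num.Theory.pnatr_eq0 -lt0n.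
  rewrite mulrA mulrC divfK //; congr (_ * _).
  by rewrite -[in LHS](prednK (ltnW (finNzRing_gt1 F))) -natr1 addrK.
have [[B sc] _ k_gt0 rk [u uk]] := extremal_NMDS_steiner hH hNMDS extr.
have ltrn : (n - k < n)%N.
  by rewrite -[X in (_ < X)%N]rk -{1}[(n - k)%N]addn0 ltn_add2l.
have lift (L : finFieldType) (iota : {rmorphism F -> L}) :
    covering_radius (lifted_code iota H) = (n - k)%N ->
    [/\ covering_radius (lifted_code iota H) = (n - k)%N,
        is_UPWS (lifted_code iota H) & is_NMDS (lifted_code iota H) k].
  have scL := steiner_lift iota sc.
  move=> Rr; split=> //; first exact: (steiner_UPWS scL).
  apply: (steiner_NMDS scL) => //; exists (map_mx iota u).
  by rewrite -map_mxM supp_map_mx.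
rewrite -hq; split=> [m lem|m' L' iota' _ _ cL' R' m lem L iota cL].
  split=> [|L iota cL]; first exact/exists_extension/(leq_trans r_gt0).
  by apply: lift; apply: (covering_radius_large_degree iota sc r_gt0 ltrn cL).
by apply: lift; apply: (covering_radius_mono_degree iota sc r_gt0 ltrn cL' cL lem R').
Qed.
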